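(* Let $(X,\mu)$ be a non-atomic measure space, $\mathcal H$ a separable Hilbert space, and $\{\phi_t\}_{t\in X}$ a continuous Bessel family in $\mathcal H$. Let $\mathcal S=\{S_{\phi,E}: E\subset X\text{ measurable}\}$ be the set of all partial frame operators. Then the closure of $\mathcal S$ in $\mathcal B(\mathcal H)$ with respect to the operator norm is convex.
   Context: A family $\{\phi_t\}_{t\in X}$ of vectors in $\mathcal H$ is a continuous Bessel family (with bound $B$) over the measure space $(X,\mu)$ if (i) for each $f\in\mathcal H$ the function $t\mapsto\langle f,\phi_t\rangle$ is measurable, and (ii) there is $B<\infty$ with $\int_X|\langle f,\phi_t\rangle|^2\,d\mu(t)\le B\|f\|^2$ for all $f\in\mathcal H$. For measurable $E\subset X$, the partial frame operator is $S_{\phi,E}f=\int_E\langle f,\phi_t\rangle\phi_t\,d\mu(t)$ (defined weakly), $f\in\mathcal H$. *)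

(* Defs.v *)
(* MathComp-Analysis measure theory + real_closed complex numbers. *)
From HB Require Import structures.
From mathcomp Require Import all_boot all_order all_algebra.
From mathcomp Require Import all_classical all_reals all_analysis.
From mathcomp Require Import complex.
Set Implicit Arguments. Unset Strict Implicit. Unset Printing Implicit Defensive.
Import Order.TTheory GRing.Theory Num.Theory.
Local Open Scope classical_set_scope.
Local Open Scope ring_scope.
Local Open Scope complex_scope.

(* ---------- Complex Hilbert spaces ---------- *)
(* A complex inner-product space is an lmodType over C = R[i] together with an
   inner product ip, linear in the first and conjugate-linear in the second
   argument. *)

(* induced norm ||x|| = sqrt <x,x> *)
Definition hnorm (R : realType) (H : lmodType R[i]) (ip : H -> H -> R[i])
  (x : H) : R := Num.sqrt (complex.Re (ip x x)).

Definition hcomplete (R : realType) (H : lmodType R[i]) (ip : H -> H -> R[i]) :=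
  forall u : nat -> H,
    (forall eps : R, 0 < eps -> exists N : nat, forall m n : nat,
        (N <= m)%N -> (N <= n)%N -> hnorm ip (u m - u n) < eps) ->
    exists l : H, forall eps : R, 0 < eps -> exists N : nat, forall n : nat,
        (N <= n)%N -> hnorm ip (u n - l) < eps.

Definition hseparable (R : realType) (H : lmodType R[i]) (ip : H -> H -> R[i]) :=
  exists s : nat -> H, forall (x : H) (eps : R), 0 < eps ->
    exists n : nat, hnorm ip (x - s n) < eps.

(* ip makes H a separable (complex) Hilbert space *)
Definition separable_hilbert (R : realType) (H : lmodType R[i])
  (ip : H -> H -> R[i]) : Prop :=
  [/\ (forall (a : R[i]) (x y z : H), ip (a *: x + y) z = a * ip x z + ip y z),
      (forall x y : H, ip x y = (ip y x)^*),
      (forall x : H, 0 <= complex.Re (ip x x)),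
      (forall x : H, ip x x = 0 -> x = 0)
    & hcomplete ip /\ hseparable ip].

(* ---------- complex-valued functions on a measure space ---------- *)
Definition cmeasurable (R : realType) (d : measure_display)
  (X : measurableType d) (F : X -> R[i]) : Prop :=
  measurable_fun setT (fun t => complex.Re (F t)) /\
  measurable_fun setT (fun t => complex.Im (F t)).

(* |z|^2 *)
Definition cabs2 (R : realType) (z : R[i]) : R :=
  complex.Re z ^+ 2 + complex.Im z ^+ 2.

(* Lebesgue integral of a complex-valued function over E *)
Definition cintegral (R : realType) (d : measure_display) (X : measurableType d)
  (mu : {measure set X -> \bar R}) (E : set X) (F : X -> R[i]) : R[i] :=
  Complex (Rintegral mu E (fun t => complex.Re (F t)))
          (Rintegral mu E (fun t => complex.Im (F t))).

(* Non-atomic measure: no atoms, where an atom is a measurable A with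
   mu A > 0 such that every measurable B ⊆ A has mu B = 0 or mu (A \ B) = 0. *)
Definition nonatomic (R : realType) (d : measure_display) (X : measurableType d)
  (mu : {measure set X -> \bar R}) : Prop :=
  forall A : set X, measurable A -> (0 < mu A)%E ->
    exists B : set X, [/\ measurable B, B `<=` A, (0 < mu B)%E
                         & (0 < mu (A `\` B))%E].

(* continuous Bessel family *)
Definition bessel_family (R : realType) (d : measure_display) (X : measurableType d)
  (mu : {measure set X -> \bar R}) (H : lmodType R[i]) (ip : H -> H -> R[i])
  (phi : X -> H) : Prop :=
  (forall f : H, cmeasurable (fun t => ip f (phi t))) /\
  exists B : R, forall f : H,
    (\int[mu]_(t in setT) (cabs2 (ip f (phi t)))%:E
       <= (B * hnorm ip f ^+ 2)%:E)%E.

(* S is the partial frame operator S_{phi,E} (defined weakly) *)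
Definition partial_frame_operator (R : realType) (d : measure_display)
  (X : measurableType d) (mu : {measure set X -> \bar R}) (H : lmodType R[i])
  (ip : H -> H -> R[i]) (phi : X -> H) (E : set X) (S : H -> H) : Prop :=
  forall f g : H,
    ip (S f) g = cintegral mu E (fun t => ip f (phi t) * ip (phi t) g).

(* the set of all partial frame operators *)
Definition partial_frame_operators (R : realType) (d : measure_display)
  (X : measurableType d) (mu : {measure set X -> \bar R}) (H : lmodType R[i])
  (ip : H -> H -> R[i]) (phi : X -> H) : set (H -> H) :=
  [set S | exists E : set X,
     measurable E /\ partial_frame_operator mu ip phi E S].

(* ---------- bounded operators, operator norm ---------- *)
Definition bounded_operator (R : realType) (H : lmodType R[i])
  (ip : H -> H -> R[i]) (T : H -> H) : Prop :=
  (forall (a : R[i]) (x y : H), T (a *: x + y) = a *: T x + T y) /\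
  exists c : R, forall x : H, hnorm ip (T x) <= c * hnorm ip x.

Definition opnorm (R : realType) (H : lmodType R[i])
  (ip : H -> H -> R[i]) (T : H -> H) : R :=
  sup [set hnorm ip (T x) | x in [set x : H | hnorm ip x <= 1]].

(* closure in B(H) w.r.t. the operator norm *)
Definition opnorm_closure (R : realType) (H : lmodType R[i])
  (ip : H -> H -> R[i]) (A : set (H -> H)) : set (H -> H) :=
  [set T | bounded_operator ip T /\
     forall eps : R, 0 < eps ->
       exists2 S, A S & opnorm ip (fun x => T x - S x) < eps].

Definition convex_opset (R : realType) (H : lmodType R[i]) (A : set (H -> H)) :=
  forall T1 T2 : H -> H, A T1 -> A T2 -> forall l : R, 0 <= l <= 1 ->
    A (fun x => (l%:C) *: T1 x + ((1 - l)%:C) *: T2 x).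

(* Main.v *)
(* An operator weakly given by [f, g |-> \int_E <f, phi_t> <phi_t, g>] is
   determined by its quadratic form [f |-> \int_E |<f, phi_t>|^2], so it is enough
   to find, in every measurable [A], a subset [F] whose form is uniformly close to
   [l] times that of [A]; for a convex combination of two operators take
   [A1 :&: A2] together with such subsets of [A1 \ A2] and [A2 \ A1].
   By separability [A] is cut, up to a set where [phi] vanishes, into countably
   many pieces [D_j] of finite measure on which [|phi_t - x_j|^2 <= w t] for a
   constant vector [x_j] and a positive weight [w] of small integral. Choosing
   [F_j] in [D_j] with [mu F_j = l * mu D_j] (Sierpinski) makes the discretized
   forms agree exactly, and the discretization error is controlled by
   [\int w] and the Bessel bound. *)
Require Import Defs.
From HB Require Import structures.
From mathcomp Require Import all_boot all_order all_algebra.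
From mathcomp Require Import all_classical all_reals all_analysis.
From mathcomp Require Import measurable_realfun complex.
From mathcomp Require Import ring lra.
Set Implicit Arguments. Unset Strict Implicit. Unset Printing Implicit Defensive.
Import Order.TTheory GRing.Theory Num.Theory.
Local Open Scope classical_set_scope.
Local Open Scope ring_scope.

(** * The underlying real Hilbert space and Riesz representation *)

Section InnerProduct.
Variables (R : realType) (H : lmodType R[i]) (ip : H -> H -> R[i]).
Hypothesis hilb : separable_hilbert ip.

(** The real inner product with the same norm as [ip]. Most of the argument runs over the reals,
    where symmetric forms polarize without complex coefficients. *)
Definition rip (x y : H) : R := complex.Re (ip x y).

Lemma ipDl x y z : ip (x + y) z = ip x z + ip y z.
Proof. by case: hilb => + _ _ _ _ => /(_ 1 x y z); rewrite scale1r mul1r. Qed.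

Lemma ip0l z : ip 0 z = 0.
Proof. by apply: (addrI (ip 0 z)); rewrite -ipDl !addr0. Qed.

Lemma ipZl a x z : ip (a *: x) z = a * ip x z.
Proof.
by case: hilb => + _ _ _ _ => /(_ a x 0 z); rewrite !addr0 ip0l addr0.
Qed.

Lemma ipC x y : ip x y = conjc (ip y x).
Proof. by case: hilb. Qed.

Lemma ipNl x z : ip (- x) z = - ip x z.
Proof. by rewrite -scaleN1r ipZl mulN1r. Qed.

Lemma ipDr x y z : ip z (x + y) = ip z x + ip z y.
Proof. by rewrite ipC ipDl (ipC z x) (ipC z y) rmorphD. Qed.

Lemma ipZr a x z : ip z (a *: x) = conjc a * ip z x.
Proof. by rewrite ipC ipZl (ipC z x) rmorphM. Qed.

Lemma ipNr x z : ip z (- x) = - ip z x.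
Proof. by rewrite ipC ipNl (ipC z x) rmorphN. Qed.

Lemma ReD (a b : R[i]) : complex.Re (a + b) = complex.Re a + complex.Re b.
Proof. by case: a b => [? ?] [? ?]. Qed.

Lemma ReN (a : R[i]) : complex.Re (- a) = - complex.Re a.
Proof. by case: a. Qed.

Lemma ReZ (r : R) (a : R[i]) : complex.Re ((r%:C)%C * a) = r * complex.Re a.
Proof. by case: a => a b /=; rewrite mul0r subr0. Qed.

Lemma rip_sym x y : rip x y = rip y x.
Proof. by rewrite /rip ipC; case: (ip y x). Qed.

Lemma ripDl x y z : rip (x + y) z = rip x z + rip y z.
Proof. by rewrite /rip ipDl ReD. Qed.

Lemma ripDr x y z : rip z (x + y) = rip z x + rip z y.
Proof. by rewrite /rip ipDr ReD. Qed.

Lemma ripNl x z : rip (- x) z = - rip x z.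
Proof. by rewrite /rip ipNl ReN. Qed.

Lemma ripNr x z : rip z (- x) = - rip z x.
Proof. by rewrite /rip ipNr ReN. Qed.

Lemma ripZl (r : R) x z : rip ((r%:C)%C *: x) z = r * rip x z.
Proof. by rewrite /rip ipZl ReZ. Qed.

Lemma ripZr (r : R) x z : rip z ((r%:C)%C *: x) = r * rip z x.
Proof. by rewrite rip_sym ripZl rip_sym. Qed.

Definition ripE := (ripDl, ripDr, ripNl, ripNr, ripZl, ripZr).

Lemma rip0l x : rip 0 x = 0.
Proof. by rewrite /rip ip0l. Qed.

Lemma rip_ge0 x : 0 <= rip x x.
Proof. by case: hilb => _ _ + _ _; apply. Qed.

Lemma rip_eq0 x : rip x x = 0 -> x = 0.
Proof.
case: hilb => _ _ _ + _ => ip_eq0 rx0; apply: ip_eq0.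
have := ipC x x; move: rx0; rewrite /rip; case: (ip x x) => a b /= -> [].
by move=> h; congr Complex; lra.
Qed.

(** Conjugate linearity in the second argument turns ['i] into [- 'i]. This is how a complex
    identity is recovered from real ones. *)
Lemma ip_imag x y : rip x ('i%C *: y) = complex.Im (ip x y).
Proof. by rewrite /rip ipZr; case: (ip x y) => a b /=; rewrite !mul0r; lra. Qed.

Lemma hnormE x : hnorm ip x = Num.sqrt (rip x x).
Proof. by []. Qed.

Lemma hnorm_ge0 x : 0 <= hnorm ip x.
Proof. exact: sqrtr_ge0. Qed.

Lemma sqr_hnorm x : hnorm ip x ^+ 2 = rip x x.
Proof. by rewrite sqr_sqrtr// rip_ge0. Qed.

Lemma hnorm_le r x : 0 <= r -> (hnorm ip x <= r) = (rip x x <= r ^+ 2).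
Proof.
move=> r0; rewrite -sqr_hnorm ler_sqr// nnegrE//; exact: hnorm_ge0.
Qed.

Lemma hnorm_lt r x : 0 <= r -> (hnorm ip x < r) = (rip x x < r ^+ 2).
Proof.
move=> r0; rewrite -sqr_hnorm ltr_sqr// nnegrE//; exact: hnorm_ge0.
Qed.

Lemma hnormZ r x : hnorm ip ((r%:C)%C *: x) = `|r| * hnorm ip x.
Proof. by rewrite !hnormE ripZl ripZr mulrA -expr2 sqrtrM ?sqr_ge0// sqrtr_sqr. Qed.

Lemma rip_CS x y : rip x y <= hnorm ip x * hnorm ip y.
Proof.
set a := hnorm ip x; set b := hnorm ip y.
have a0 : 0 <= a := hnorm_ge0 x.
have b0 : 0 <= b := hnorm_ge0 y.
have [b_eq0|bn0] := eqVneq b 0.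
  have /rip_eq0 -> : rip y y = 0 by rewrite -sqr_hnorm -/b b_eq0 expr0n.
  by rewrite rip_sym rip0l mulr_ge0.
have bp : 0 < b by rewrite lt0r bn0.
have [a_eq0|an0] := eqVneq a 0.
  have /rip_eq0 -> : rip x x = 0 by rewrite -sqr_hnorm -/a a_eq0 expr0n.
  by rewrite rip0l mulr_ge0.
have ap : 0 < a by rewrite lt0r an0.
(* With [a = |x|] and [b = |y|] the square expands to [2ab (ab - <x,y>)]. *)
have := rip_ge0 ((b%:C)%C *: x - (a%:C)%C *: y).
rewrite !ripE -!sqr_hnorm -/a -/b (rip_sym y x) => h.
have {h} : 0 <= (a * b) * (2 * (a * b - rip x y)) by move: h; congr (_ <= _); ring.
by rewrite pmulr_rge0 ?mulr_gt0// => h; lra.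
Qed.

Lemma hnormD x y : hnorm ip (x + y) <= hnorm ip x + hnorm ip y.
Proof.
rewrite hnorm_le ?addr_ge0 ?hnorm_ge0// !ripE (rip_sym y x) -!sqr_hnorm.
have := rip_CS x y; rewrite sqrrD; lra.
Qed.

(** Tested at [y = x / |x|]. It reduces operator bounds to bounds on real bilinear forms over the
    unit ball. *)
Lemma hnorm_le1_unit x c : 0 <= c ->
  (forall y, hnorm ip y <= 1 -> rip x y <= c) -> hnorm ip x <= c.
Proof.
move=> c0 h; have [x0|xn0] := eqVneq (hnorm ip x) 0; first by rewrite x0.
have xp : 0 < hnorm ip x by rewrite lt0r xn0 hnorm_ge0.
have := h (((hnorm ip x)^-1%:C)%C *: x).
rewrite hnormZ ger0_norm ?invr_ge0 ?hnorm_ge0// mulVf// lexx => /(_ isT).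
by rewrite ripZr -sqr_hnorm expr2 mulKf.
Qed.

(** Cauchy-Schwarz for the full complex product, from the nonnegative square of
    [|y|^2 x - <x,y> y]. *)
Lemma cabs2_ip_le x y : cabs2 (ip x y) <= rip x x * rip y y.
Proof.
have [/rip_eq0 ->|yn0] := eqVneq (rip y y) 0.
  by rewrite ipC ip0l rmorph0 /cabs2 /= expr0n/= addr0 rip0l mulr0.
have yp : 0 < rip y y by rewrite lt0r yn0 rip_ge0.
have := rip_ge0 (((rip y y)%:C)%C *: x - ip x y *: y).
rewrite /rip !(ipDl, ipDr, ipNl, ipNr, ipZl, ipZr).
have xE : ip x x = ((rip x x)%:C)%C.
  by have := ipC x x; rewrite /rip; case: (ip x x) => a b /= [] h; congr Complex; lra.
have yE : ip y y = ((rip y y)%:C)%C.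
  by have := ipC y y; rewrite /rip; case: (ip y y) => a b /= [] h; congr Complex; lra.
rewrite xE yE (ipC y x) /cabs2; case: (ip x y) => a b /= h.
move: (rip x x) (rip y y) yp h => u v v0 h.
have {h} : 0 <= v * (u * v - (a ^+ 2 + b ^+ 2)) by move: h; congr (_ <= _); ring.
by rewrite pmulr_rge0// subr_ge0.
Qed.

(* [|v|^2] is the supremum of [2 Re <s, v> - |s|^2] over a dense set of [s],
   the defect being [|v - s|^2]. *)
Lemma rip_dense_le (s : nat -> H) (v : H) (c : R) :
  (forall (x : H) (eps : R), 0 < eps -> exists n, hnorm ip (x - s n) < eps) ->
  (forall k, 2 * rip (s k) v - rip (s k) (s k) <= c) -> rip v v <= c.
Proof.
move=> sd h; rewrite leNgt; apply/negP => cv.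
have e0 : 0 < Num.sqrt (rip v v - c) by rewrite sqrtr_gt0 subr_gt0.
have [n] := sd v _ e0.
rewrite hnorm_lt ?ltW// sqr_sqrtr ?subr_ge0 ?ltW// !ripE (rip_sym v).
by have := h n; lra.
Qed.

(* The minimizing sequence of [|x|^2 - 2 l x] is Cauchy by the parallelogram
   law, and its limit represents [l]. *)
Lemma riesz (l : H -> R) :
  (forall x y, l (x + y) = l x + l y) ->
  (forall (r : R) x, l ((r%:C)%C *: x) = r * l x) ->
  (exists m, forall x, 2 * l x <= rip x x + m) ->
  exists x, forall y, rip x y = l y.
Proof.
move=> lD lZ [m lm].
pose J x := rip x x - 2 * l x.
pose A := range J.
have Ainf : has_inf A.
  split; first by exists (J 0), 0.
  by exists (- m) => _ [x _ <-]; rewrite /J; have := lm x; lra.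
have Jge x : inf A <= J x by apply: ge_inf; [exact: Ainf.2|exists x].
have /choice[u uJ] : forall n : nat, exists x, J x < inf A + n.+1%:R^-1.
  move=> n; have n0 : 0 < n.+1%:R^-1 :> R by rewrite invr_gt0.
  by have [_ [x _ <-] ?] := inf_adherent n0 Ainf; exists x.
(* Compare [J] at the midpoint, where it is at least [inf A], with its values at [u n] and [u k]:
   the gap between their mean and the midpoint value is [|u n - u k|^2 / 4]. *)
have cauchy (n k : nat) :
    rip (u n - u k) (u n - u k) <= 2 * n.+1%:R^-1 + 2 * k.+1%:R^-1.
  have := Jge (((2^-1)%:C)%C *: (u n + u k)).
  have := uJ n; have := uJ k; rewrite /J !lZ !lD !ripE (rip_sym (u k) (u n)).
  move: (n.+1%:R^-1) (k.+1%:R^-1) => a b.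
  lra.
case: hilb => _ _ _ _ [hc _].
have [|x xlim] := hc u.
  move=> e e0; have e2 : 0 < e ^+ 2 / 4 by rewrite divr_gt0 ?exprn_gt0.
  have [N _ hN] := near_infty_natSinv_lt (PosNum e2).
  exists N => p q Np Nq; rewrite hnorm_lt ?ltW//.
  apply: le_lt_trans (cauchy p q) _.
  have /= := hN p Np; have /= := hN q Nq.
  by move: (p.+1%:R^-1) (q.+1%:R^-1) => a b; lra.
exists x => y.
(* First variation of [J] in direction [y]. If the expression [D] were negative, for large [n] both
   the error from replacing [x] by [u n] and the slack in [uJ n] would be at most [- D / 2], which
   is contradictory. *)
have key (t : R) : 0 <= t ^+ 2 * rip y y + 2 * t * (rip x y - l y).
  rewrite leNgt; apply/negP; set D := _ + _ => D0.
  pose c := 2 * `|t| * hnorm ip y + 1.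
  have c0 : 0 < c by rewrite ltr_wpDl// !mulr_ge0// hnorm_ge0.
  have e1 : 0 < - D / (2 * c) by rewrite divr_gt0 ?mulr_gt0// oppr_gt0.
  have e2 : 0 < - D / 2 by lra.
  have [N1 hN1] := xlim _ e1.
  have [N2 _ hN2] := near_infty_natSinv_lt (PosNum e2).
  have {hN1} /= h1 := hN1 (maxn N1 N2) (leq_maxl _ _).
  have {hN2} /= h2 := hN2 (maxn N1 N2) (leq_maxr _ _).
  set n := maxn _ _ in h1 h2.
  have := Jge (u n + (t%:C)%C *: y); have := uJ n.
  rewrite /J lD lZ !ripE (rip_sym y) => h3 h4.
  have := rip_CS (u n - x) ((2 * t)%:C%C *: y).
  rewrite hnormZ normrM (ger0_norm (ler0n _ _)) !ripE => h5.
  have h6 : hnorm ip (u n - x) * (2 * `|t| * hnorm ip y) <= - D / 2.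
    apply: (@le_trans _ _ (hnorm ip (u n - x) * c)).
      by apply: ler_wpM2l; [exact: hnorm_ge0|rewrite /c; lra].
    by rewrite -ler_pdivlMr// ltW// (lt_le_trans h1)// invfM mulrA.
  by move: D0 h5 h6 h2 h3 h4; rewrite /D /=; move: (n.+1%:R^-1) => a; lra.
set z := rip x y - l y in key.
(* The step [t = - z w] makes the variation equal to [- z^2 w (1 + w)]; the added 1 avoids a
   separate case [y = 0]. *)
pose w := (rip y y + 1)^-1.
have w0 : 0 < w by rewrite invr_gt0 ltr_wpDl// rip_ge0.
have wy : w * rip y y = 1 - w.
  have : w * (rip y y + 1) = 1 by rewrite mulVf// gt_eqF// ltr_wpDl// rip_ge0.
  by lra.
have := key (- z * w).
have -> : (- z * w) ^+ 2 * rip y y + 2 * (- z * w) * z = z ^+ 2 * w * (w * rip y y - 2).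
  by ring.
rewrite wy => h; apply/eqP; rewrite -subr_eq0 -/z -sqrf_eq0 eq_le sqr_ge0 andbT.
rewrite leNgt; apply/negP => z0; have : 0 < z ^+ 2 * w * (1 + w).
  by apply: mulr_gt0; [exact: mulr_gt0|rewrite addr_gt0].
by lra.
Qed.

End InnerProduct.

(** * Intermediate values of a non-atomic measure *)

Section Sierpinski.
Context (R : realType) (d : measure_display) (X : measurableType d).
Variable mu : {measure set X -> \bar R}.
Hypothesis na : nonatomic mu.
Variable A : set X.
Hypotheses (mA : measurable A) (Afin : (mu A < +oo)%E).

(** Only subsets of [A] matter, where [mu] is finite, so the arithmetic can be done in the reals. *)
Let m (B : set X) : R := fine (mu B).

Let mE B : measurable B -> B `<=` A -> mu B = (m B)%:E.
Proof.
move=> mB BA; rewrite fineK// ge0_fin_numE//.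
by apply: le_lt_trans Afin; apply: le_measure; rewrite ?inE.
Qed.

Let m_setD B C : measurable B -> measurable C -> B `<=` C -> C `<=` A ->
  m (C `\` B) = m C - m B.
Proof.
move=> mB mC BC CA; have mCB : measurable (C `\` B) by exact: measurableD.
have BA : B `<=` A by exact: subset_trans CA.
have CBA : C `\` B `<=` A by move=> x [/CA].
have : mu C = (mu (C `\` B) + mu B)%E by rewrite (measureDI mu mC mB) (setIidr BC).
by rewrite !mE// -EFinD => -[->]; rewrite addrK.
Qed.

Let m_ge0 B : 0 <= m B.
Proof. exact: fine_ge0. Qed.

Let m_le B C : measurable B -> measurable C -> B `<=` C -> C `<=` A ->
  m B <= m C.
Proof.
move=> mB mC BC CA; have := m_setD mB mC BC CA.
by have := m_ge0 (C `\` B); lra.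
Qed.

(** Of the two parts of a nontrivial splitting, one has at most half the measure. *)
Let nonatomic_half B : measurable B -> B `<=` A -> 0 < m B ->
  exists C, [/\ measurable C, C `<=` B, 0 < m C & 2 * m C <= m B].
Proof.
move=> mB BA B0; have [|C [mC CB C0 BC0]] := na mB.
  by rewrite mE// lte_fin.
have mBC : measurable (B `\` C) by exact: measurableD.
have CA : C `<=` A by exact: subset_trans BA.
have BCA : B `\` C `<=` A by move=> x [/BA].
rewrite (mE mC)// lte_fin in C0; rewrite (mE mBC)// lte_fin in BC0.
have := m_setD mC mB CB BA => D.
have [h|h] := leP (2 * m C) (m B); first by exists C.
by exists (B `\` C); split => //; lra.
Qed.

Let nonatomic_small B (e : R) : measurable B -> B `<=` A -> 0 < m B -> 0 < e ->
  exists C, [/\ measurable C, C `<=` B, 0 < m C & m C <= e].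
Proof.
move=> mB BA B0 e0.
have halves n : exists C, [/\ measurable C, C `<=` B, 0 < m C & 2 ^+ n * m C <= m B].
  elim: n => [|n [C [mC CB C0 hC]]]; first by exists B; split; rewrite ?expr0 ?mul1r.
  have [D [mD DC D0 hD]] := nonatomic_half mC (subset_trans CB BA) C0.
  exists D; split => //; first exact: subset_trans CB.
  by apply: le_trans hC; rewrite exprSr -mulrA ler_wpM2l// exprn_ge0.
have [n hn] : exists n : nat, m B / e <= 2 ^+ n.
  exists (Num.truncn (m B / e)).+1; apply: (@le_trans _ _ (Num.truncn (m B / e)).+1%:R).
    by rewrite ltW// truncnS_gt.
  by rewrite -natrX ler_nat ltnW// ltn_expl.
have [C [mC CB C0 hC]] := halves n; exists C; split => //.
rewrite ler_pdivrMr// in hn.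
by have := le_trans hC hn; rewrite ler_pM2l// exprn_gt0.
Qed.

(* Greedy exhaustion: each step adds an admissible set of at least half the
   largest admissible measure, so a deficit at the end would leave room for a
   set of positive measure that was admissible at every step. *)
Lemma nonatomic_intermediate (c : R) : 0 <= c -> (c%:E <= mu A)%E ->
  exists F, [/\ measurable F, F `<=` A & mu F = c%:E].
Proof.
move=> c0; rewrite mE// lee_fin => cA.
pose P F := [/\ measurable F, F `<=` A & m F <= c].
pose admissible F G := [/\ measurable G, G `<=` A `\` F & m F + m G <= c].
have step (F : {F | P F}) : exists F' : {F | P F},
    sval F `<=` sval F' /\ forall G, admissible (sval F) G ->
      m G <= 2 * (m (sval F') - m (sval F)).
  case: F => F [mF FA Fc] /=.
  pose V := [set m G | G in admissible F].
  have Vsup : has_sup V.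
    split; first by exists (m set0), set0 => //; split; rewrite // /m measure0/= addr0.
    by exists c => _ [G [mG GF h] <-]; have := m_ge0 F; lra.
  (* The supremum need not be attained, hence the factor 2; if it is 0 the empty set serves. *)
  have [G [mG GF h] hG] : exists2 G, admissible F G & sup V <= 2 * m G.
    have [V0|V0] := leP (sup V) 0.
      exists set0; first by split; rewrite // /m measure0/= addr0.
      by rewrite (le_trans V0)// mulr_ge0.
    have e0 : 0 < sup V / 2 by rewrite divr_gt0.
    have [_ [G adG <-] hG] := sup_adherent e0 Vsup.
    by exists G => //; lra.
  have mFG : measurable (F `|` G) by exact: measurableU.
  have GA : G `<=` A by move=> x /GF[].
  have FGA : F `|` G `<=` A by rewrite subUset.
  have mFGE : m (F `|` G) = m F + m G.
    have := m_setD mF mFG (@subsetUl _ F G) FGA.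
    rewrite setDUl setDv set0U (_ : G `\` F = G); first by lra.
    by apply/seteqP; split => [x []//|x Gx]; split => // Fx; have [_] := GF x Gx.
  have PFG : P (F `|` G) by split; rewrite ?mFGE.
  exists (exist _ _ PFG); split; first exact: subsetUl.
  move=> G' adG' /=; rewrite mFGE; apply: (@le_trans _ _ (sup V)).
    by apply: sup_ubound; [exact: Vsup.2|exists G'].
  lra.
have /choice[next nextP] := step.
have P0 : P set0 by split; rewrite // /m measure0.
pose F n := iter n next (exist _ _ P0).
pose f n := sval (F n).
have fP n : P (f n) by exact: (svalP (F n)).
have mf n : measurable (f n) by have [] := fP n.
have mUf : measurable (\bigcup_n f n) by exact: bigcup_measurable.
have UfA : \bigcup_n f n `<=` A by apply: bigcup_sub => n _; have [] := fP n.
have ndf : nondecreasing_seq f.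
  by apply/nondecreasing_seqP => n; rewrite subsetEset; have [] := nextP (F n).
have Uc : m (\bigcup_n f n) <= c.
  rewrite -lee_fin -mE//; have cvgf := nondecreasing_cvg_mu (mu := mu) mf mUf ndf.
  rewrite -(cvg_lim _ cvgf)//; apply: lime_le; first exact: cvgP cvgf.
  by apply: nearW => n /=; have [_ fA fc] := fP n; rewrite mE.
exists (\bigcup_n f n); split => //; rewrite mE//; congr EFin.
apply/eqP; rewrite eq_le Uc /= leNgt; apply/negP => Uc'.
have mAU : measurable (A `\` \bigcup_n f n) by exact: measurableD.
have D0 : 0 < m (A `\` \bigcup_n f n) by rewrite m_setD//; lra.
have e0 : 0 < c - m (\bigcup_n f n) by rewrite subr_gt0.
have [G [mG GA G0 Ge]] := nonatomic_small mAU (@subDsetl _ _ _) D0 e0.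
have adG n : admissible (f n) G.
  have fU : f n `<=` \bigcup_n f n by exact: bigcup_sup.
  split => //; first by move=> x /GA[Ax nUx]; split => // /fU.
  by have := m_le (mf n) mUf fU UfA; lra.
(* Each stage gains at least half of [m G], which eventually exceeds the budget [c]. *)
have grow n : n%:R * m G <= 2 * m (f n).
  elim: n => [|n IHn]; first by rewrite mul0r mulr_ge0.
  by have [_ /(_ _ (adG n))] := nextP (F n); rewrite -/(f n) -/(f n.+1) -natr1; lra.
have [n hn] : exists n : nat, 2 * c / m G < n%:R.
  by exists (Num.truncn (2 * c / m G)).+1; rewrite truncnS_gt.
rewrite ltr_pdivrMr// in hn.
by have [_ _ fc] := fP n; have := grow n; lra.
Qed.

End Sierpinski.

(** * Comparing integrals through piecewise constant approximation *)

Section Balancing.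
Context (R : realType) (d : measure_display) (X : measurableType d).
Variable mu : {measure set X -> \bar R}.
Variables (D : nat -> set X) (p G : X -> \bar R) (q : nat -> R).
Hypotheses (mD : forall j, measurable (D j)) (tD : trivIset setT D).
Hypotheses (mp : measurable_fun setT p) (mG : measurable_fun setT G).
Hypotheses (p0 : forall t, (0 <= p t)%E) (G0 : forall t, (0 <= G t)%E).
Hypothesis q0 : forall j, 0 <= q j.
Hypothesis pq : forall j t, D j t -> (p t <= (q j)%:E + G t)%E.
Hypothesis qp : forall j t, D j t -> ((q j)%:E <= p t + G t)%E.

Let ge0_integral_sub E (f : X -> \bar R) j :
  measurable_fun setT f -> (forall t, (0 <= f t)%E) ->
  measurable E -> E `<=` D j ->
  (\int[mu]_(x in E) f x <= \int[mu]_(x in D j) f x)%E.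
Proof.
by move=> mf f0 mE ED; apply: ge0_subset_integral => //; exact: measurable_funTS.
Qed.

Let weighted_le1 (a : R) (x : \bar R) : 0 <= a <= 1 -> (0 <= x)%E ->
  (a%:E * x <= x)%E.
Proof.
move=> /andP[a0 a1] x0; rewrite -[leRHS]mul1e; by apply: lee_wpmul2r; rewrite ?lee_fin.
Qed.

(** Replace [p] by the constant [q j] on [U], move its mass from [U] to [V] by the balance of
    measures, and replace [q j] by [p] on [V]. As [a] and [b] are at most 1, each replacement costs
    at most the integral of [G] over [D j]. The hypotheses [pq] and [qp] are two one-sided bounds
    because [p] and [G] may be infinite. *)
Let balanced_piece (a b : R) (U V : set X) j : 0 <= a <= 1 -> 0 <= b <= 1 ->
  measurable U -> measurable V -> U `<=` D j -> V `<=` D j ->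
  (a%:E * mu U = b%:E * mu V)%E ->
  (a%:E * \int[mu]_(x in U) p x <= b%:E * \int[mu]_(x in V) p x
     + (\int[mu]_(x in D j) G x + \int[mu]_(x in D j) G x))%E.
Proof.
move=> a01 b01 mU mV UD VD aUbV.
have [a0 b0] : 0 <= a /\ 0 <= b by case/andP: a01; case/andP: b01.
apply: (@le_trans _ _ (a%:E * ((q j)%:E * mu U) + a%:E * \int[mu]_(x in U) G x)%E).
  rewrite -ge0_muleDr; [|by rewrite mule_ge0 ?lee_fin|exact: integral_ge0].
  apply: lee_wpmul2l; first by rewrite lee_fin.
  rewrite -integral_cst// -ge0_integralD//=; last 2 first.
    by move=> t _; rewrite lee_fin.
    exact: measurable_funTS.
  apply: ge0_le_integral => //; first exact: measurable_funTS.
    by apply: emeasurable_funD => //; exact: measurable_funTS.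
  by move=> t /UD; exact: pq.
rewrite muleCA aUbV muleCA addeA; apply: leeD; last first.
  apply: le_trans (ge0_integral_sub mG G0 mU UD).
  by apply: weighted_le1 => //; exact: integral_ge0.
apply: (@le_trans _ _ (b%:E * \int[mu]_(x in V) p x + b%:E * \int[mu]_(x in V) G x)%E).
  rewrite -ge0_muleDr; [|exact: integral_ge0|exact: integral_ge0].
  apply: lee_wpmul2l; first by rewrite lee_fin.
  rewrite -integral_cst// -ge0_integralD//=; [|exact: measurable_funTS..].
  apply: ge0_le_integral => //; first by move=> t _; rewrite lee_fin.
    by apply: emeasurable_funD => //; exact: measurable_funTS.
  by move=> t /VD; exact: qp.
apply: leeD => //; apply: le_trans (ge0_integral_sub mG G0 mV VD).
by apply: weighted_le1 => //; exact: integral_ge0.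
Qed.

Lemma balanced_integral_le (a b : R) (U V : nat -> set X) :
  0 <= a <= 1 -> 0 <= b <= 1 ->
  (forall j, measurable (U j)) -> (forall j, measurable (V j)) ->
  (forall j, U j `<=` D j) -> (forall j, V j `<=` D j) ->
  (forall j, a%:E * mu (U j) = b%:E * mu (V j))%E ->
  (a%:E * \int[mu]_(x in \bigcup_j U j) p x
     <= b%:E * \int[mu]_(x in \bigcup_j V j) p x
        + (\int[mu]_(x in \bigcup_j D j) G x + \int[mu]_(x in \bigcup_j D j) G x))%E.
Proof.
move=> a01 b01 mU mV UD VD aUbV.
have sub_triv (W : nat -> set X) : (forall j, W j `<=` D j) -> trivIset setT W.
  move=> WD i j _ _ [t [/WD Di /WD Dj]].
  by apply: tD => //; exists t.
have int0 (W : set X) (f : X -> \bar R) : (forall t, (0 <= f t)%E) ->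
  (0 <= \int[mu]_(x in W) f x)%E by move=> f0; exact: integral_ge0.
do 2 (rewrite ge0_integral_bigcup//; [|exact: measurable_funTS|exact: sub_triv]).
rewrite ge0_integral_bigcup//; [|exact: measurable_funTS].
rewrite -!nneseriesZl; [|by move=> ? _; exact: int0..].
have b0 : (0 <= b%:E)%E by rewrite lee_fin; case/andP: b01.
rewrite -nneseriesD => [|j _ _|j _ _]; [|exact: int0..].
rewrite -nneseriesD => [|j _ _|j _ _]; last 2 first.
- by rewrite mule_ge0// int0.
- by rewrite adde_ge0// int0.
apply: lee_nneseries => [j _ _|j _]; last exact: balanced_piece.
by rewrite mule_ge0 ?int0// lee_fin; case/andP: a01.
Qed.

End Balancing.

(** * Scalar perturbation inequalities *)

Lemma cabs2_ge0 (R : realType) (z : R[i]) : 0 <= cabs2 z.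
Proof. by rewrite addr_ge0 ?sqr_ge0. Qed.

Lemma young_sqr (R : realType) (e u v : R) : 0 < e ->
  2 * `|u * v| <= e * u ^+ 2 + e^-1 * v ^+ 2.
Proof.
move=> e0; rewrite normrM -subr_ge0.
have uE : u ^+ 2 = `|u| ^+ 2 by rewrite real_normK// num_real.
have vE : v ^+ 2 = `|v| ^+ 2 by rewrite real_normK// num_real.
have -> : e * u ^+ 2 + e^-1 * v ^+ 2 - 2 * (`|u| * `|v|)
          = e^-1 * (e * `|u| - `|v|) ^+ 2.
  by rewrite uE vE; field; rewrite gt_eqF.
by rewrite mulr_ge0 ?sqr_ge0// invr_ge0 ltW.
Qed.

(** Young's inequality on the cross term of [|z - (z - w)|^2]. Both errors are expressed through
    [z], which will be a frame coefficient and so is controlled by the Bessel bound. *)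
Lemma cabs2_perturb (R : realType) (e : R) (z w : R[i]) : 0 < e ->
  cabs2 z <= cabs2 w + (e * cabs2 z + (1 + e^-1) * cabs2 (z - w)) /\
  cabs2 w <= cabs2 z + (e * cabs2 z + (1 + e^-1) * cabs2 (z - w)).
Proof.
move=> e0; case: z w => [a b] [a' b']; rewrite /cabs2 /=.
have := young_sqr a (a - a') e0; have := young_sqr b (b - b') e0.
have := ler_norm (a * (a - a')); have := ler_norm (b * (b - b')).
have := ler_norm (- (a * (a - a'))); have := ler_norm (- (b * (b - b'))).
rewrite !normrN.
have := sqr_ge0 (a - a'); have := sqr_ge0 (b - b').
move: (e^-1) => f; split; nra.
Qed.

(** * Frame coefficients and an integrable weight *)

Section Frame.
Context (R : realType) (d : measure_display) (X : measurableType d).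
Variables (mu : {measure set X -> \bar R}) (H : lmodType R[i]).
Variables (ip : H -> H -> R[i]) (phi : X -> H).
Hypothesis hilb : separable_hilbert ip.
Hypothesis bessel : bessel_family mu ip phi.

Local Notation rip := (rip ip).

Definition coef2 (f : H) (t : X) : R := cabs2 (ip f (phi t)).

Lemma coef2_ge0 f t : 0 <= coef2 f t.
Proof. exact: cabs2_ge0. Qed.

Lemma measurable_Re_ip f : measurable_fun setT (fun t => complex.Re (ip f (phi t))).
Proof. by have [] := bessel.1 f. Qed.

Lemma measurable_Im_ip f : measurable_fun setT (fun t => complex.Im (ip f (phi t))).
Proof. by have [] := bessel.1 f. Qed.

Lemma measurable_coef2 f : measurable_fun setT (coef2 f).
Proof.
by apply: measurable_funD; apply: measurable_funX;
  [exact: measurable_Re_ip|exact: measurable_Im_ip].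
Qed.

Lemma measurable_coef2_EFin f : measurable_fun setT (fun t => (coef2 f t)%:E).
Proof. exact/measurable_EFinP/measurable_coef2. Qed.

Lemma bessel_bound : exists B : R, 0 <= B /\
  forall f, (\int[mu]_t (coef2 f t)%:E <= (B * rip f f)%:E)%E.
Proof.
have [_ [B hB]] := bessel; exists `|B|; split => // f.
apply: (le_trans (hB f)); rewrite sqr_hnorm// lee_fin ler_wpM2r ?rip_ge0//.
exact: ler_norm.
Qed.

Section Weight.
Variables (s : nat -> H) (eta : R).
Hypothesis s_dense : forall (x : H) (eps : R), 0 < eps ->
  exists n : nat, hnorm ip (x - s n) < eps.
Hypothesis eta0 : 0 < eta.

(* An integrable weight, positive wherever [phi] does not vanish, against
   which the discretization error of [phi] is measured. *)
Lemma exists_weight : exists w : X -> \bar R,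
  [/\ measurable_fun setT w, forall t, (0 <= w t)%E,
      (\int[mu]_t w t <= eta%:E)%E & forall t, phi t <> 0 -> (0 < w t)%E].
Proof.
have [B [B0 hB]] := bessel_bound.
(* By the Bessel bound the [k]-th term then has integral at most [eta / 2^(k+1)]; the added 1 keeps
   the denominator positive. *)
pose c k := eta / (2 ^ k.+1)%:R / (B * rip (s k) (s k) + 1).
have den k : 0 < B * rip (s k) (s k) + 1.
  by rewrite ltr_wpDl// mulr_ge0// rip_ge0.
have c0 k : 0 < c k by rewrite !divr_gt0// ltr0n expn_gt0.
pose h k t := ((c k)%:E * (coef2 (s k) t)%:E)%E.
have h0 k t : (0 <= h k t)%E.
  by rewrite mule_ge0// lee_fin ?coef2_ge0// ltW.
have mh k : measurable_fun setT (h k).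
  exact/measurable_funeM/measurable_coef2_EFin.
exists (fun t => \sum_(0 <= k <oo) h k t)%E; split.
- by apply: ge0_emeasurable_sum => // k t _ _.
- by move=> t; apply: nneseries_ge0.
- rewrite integral_nneseries//; apply: le_trans (epsilon_trick0 xpredT (ltW eta0)).
  apply: lee_nneseries => [k _ _|k _]; first by apply: integral_ge0.
  rewrite ge0_integralZl_EFin//; last 3 first.
  + by move=> t _; rewrite lee_fin coef2_ge0.
  + exact: measurable_coef2_EFin.
  + exact: ltW.
  apply: (@le_trans _ _ ((c k)%:E * (B * rip (s k) (s k))%:E)%E).
    by apply: lee_wpmul2l => //; rewrite lee_fin ltW.
  have y0 : 0 <= eta / (2 ^ k.+1)%:R by rewrite divr_ge0 ?ltW.
  rewrite -EFinM lee_fin /c mulrAC ler_pdivrMr//; apply: ler_wpM2l => //.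
  by rewrite lerDl.
- move=> t pt0.
  have rp : 0 < rip (phi t) (phi t).
    rewrite lt0r rip_ge0// andbT; apply/eqP => /(rip_eq0 hilb).
    exact: pt0.
  (* A point [s k] closer to [phi t] than 0 is satisfies [2 Re <s k, phi t> > |s k|^2]. *)
  have [k hk] : exists k, 0 < coef2 (s k) t.
    have rp' : 0 < Num.sqrt (rip (phi t) (phi t)) by rewrite sqrtr_gt0.
    have [k] := s_dense (phi t) rp'.
    rewrite hnorm_lt ?ltW// sqr_sqrtr ?ltW// !(ripE hilb) (rip_sym hilb (phi t)) => hk.
    exists k; have sk := rip_ge0 hilb (s k).
    have : 0 < rip (s k) (phi t) by lra.
    rewrite /coef2 /cabs2 /rip => hr.
    by rewrite ltr_wpDr ?sqr_ge0// exprn_gt0.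
  apply: lt_le_trans (nneseries_lim_ge k.+1 _) => //.
  rewrite big_nat_recr//=; apply: (@lt_le_trans _ _ (h k t)).
    by rewrite mule_gt0// lte_fin.
  by apply: leeDr; apply: sume_ge0.
Qed.

End Weight.

(** * Subsets carrying a prescribed proportion of the quadratic form *)

Hypothesis na : nonatomic mu.

(** The integrand vanishes with [phi]. This discards the part of [A] that the pieces of finite
    measure may miss. *)
Lemma integral_coef2_support A U f : measurable A -> measurable U -> U `<=` A ->
  (forall t, A t -> phi t <> 0 -> U t) ->
  (\int[mu]_(t in A) (coef2 f t)%:E = \int[mu]_(t in U) (coef2 f t)%:E)%E.
Proof.
move=> mA mU UA AU; have mAU : measurable (A `\` U) by exact: measurableD.
have c0 t : (0 <= (coef2 f t)%:E)%E by rewrite lee_fin coef2_ge0.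
rewrite -{1}(setDUK UA) ge0_integral_setU//; last 2 first.
- exact/measurable_funTS/measurable_coef2_EFin.
- by apply/disj_setPS => t [Ut [_]].
rewrite [X in (_ + X)%E]integral0_eq ?adde0// => t [At nUt].
have [pt0|/eqP pt0] := eqVneq (phi t) 0; last by have := AU _ At pt0.
by rewrite /coef2 pt0 (ipC hilb) (ip0l hilb) rmorph0 /cabs2 /= expr0n/= addr0.
Qed.

Lemma frame_proportional_subset (A : set X) (l e : R) :
  measurable A -> 0 <= l <= 1 -> 0 < e ->
  exists F, [/\ measurable F, F `<=` A & forall f,
    (\int[mu]_(t in F) (coef2 f t)%:E
      <= l%:E * \int[mu]_(t in A) (coef2 f t)%:E + (e * rip f f)%:E)%E /\
    (l%:E * \int[mu]_(t in A) (coef2 f t)%:E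
      <= \int[mu]_(t in F) (coef2 f t)%:E + (e * rip f f)%:E)%E].
Proof.
move=> mA l01 e0; have [B [B0 hB]] := bessel_bound.
have [s s_dense] : hseparable ip by case: hilb => _ _ _ _ [].
(* [del] and [eta] are tuned so that the two terms of the error [G] below integrate to at most
   [e/4 |f|^2] each; [G] is paid twice, for a total of [e |f|^2]. *)
pose del := e / (4 * (B + 1)).
have del0 : 0 < del by rewrite divr_gt0// mulr_gt0// ltr_wpDl.
pose eta := e / (4 * (1 + del^-1)).
have idel0 : 0 < 1 + del^-1 by rewrite addr_gt0// invr_gt0.
have eta0 : 0 < eta by rewrite divr_gt0// mulr_gt0.
have [w [mw w0 iw wp]] := exists_weight s_dense eta0.
(* The lower bound on [w] makes the measure finite by Markov's inequality. The condition over all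
   [k] encodes [|phi t - s n|^2 <= w t] through countably many functions that are measurable by the
   weak measurability of [phi]. *)
pose P (n m : nat) := [set t | [/\ A t, (m.+1%:R^-1%:E <= w t)%E &
  forall k, ((2 * rip (s k) (phi t - s n) - rip (s k) (s k))%:E <= w t)%E]].
have mP n m : measurable (P n m).
  have -> : P n m = A `&` ([set: X] `&` [set t | (m.+1%:R^-1%:E <= w t)%E]) `&`
      \bigcap_k ([set: X] `&` [set t |
        ((2 * rip (s k) (phi t - s n) - rip (s k) (s k))%:E <= w t)%E]).
    apply/seteqP; split => t.
      by case=> At wt h; split => // k _; split => //; exact: h.
    by case=> [[At [_ wt]] h]; split => // k; have [] := h k I.
  apply: measurableI; first apply: measurableI => //.
    by apply: measurable_lee => //; exact: measurable_cst.
  apply: bigcap_measurable => // k _; apply: measurable_lee => //.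
  apply/measurable_EFinP; apply: measurable_funB => //.
  under eq_fun do rewrite (ripDr hilb); apply: measurable_funM => //.
  by apply: measurable_funD => //; exact: measurable_Re_ip.
have Pfin n m : (mu (P n m) < +oo)%E.
  have : ((m.+1%:R^-1)%:E * mu (P n m) <= eta%:E)%E.
    rewrite -integral_cst//; apply: le_trans iw.
    apply: (@le_trans _ _ (\int[mu]_(t in P n m) w t)%E).
      apply: ge0_le_integral => //; last by move=> t [].
        by move=> t _; rewrite /= lee_fin.
      exact: measurable_funTS.
    exact: (@ge0_subset_integral _ _ _ mu (P n m) setT).
  have := measure_ge0 mu (P n m); case: (mu (P n m)) => [r _ _| _|//].
    exact: ltry.
  by rewrite gt0_muley ?lte_fin ?invr_gt0// leye_eq.
(* Enumerates the pairs [(n, m)]. A code of no pair only repeats [P 0 0], and [seqDU] removes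
   overlaps. *)
pose Q j := let nm := odflt (0%N, 0%N) (unpickle j) in P nm.1 nm.2.
have mQ j : measurable (Q j) by exact: mP.
pose D := seqDU Q.
have mD j : measurable (D j) by exact: seqDU_measurable.
have tD : trivIset setT D by exact: trivIset_seqDU.
have DQ j : D j `<=` Q j by exact: subset_seqDU.
have DA j : D j `<=` A by move=> t /DQ[].
have mUD : measurable (\bigcup_j D j) by exact: bigcup_measurable.
have UDA : \bigcup_j D j `<=` A by exact: bigcup_sub.
have AUD t : A t -> phi t <> 0 -> (\bigcup_j D j) t.
  move=> At /wp wt; rewrite -seqDU_bigcup_eq.
  (* [w t] may be infinite, so a positive real below it sets the precision for [m] and [n]. *)
  have [r r0 rw] : exists2 r : R, 0 < r & (r%:E <= w t)%E.
    case: (w t) wt => [r||//]; first by rewrite lte_fin => r0; exists r.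
    by move=> _; exists 1 => //; exact: leey.
  have [m _ /(_ m (leqnn m)) hm] := near_infty_natSinv_lt (PosNum r0).
  have r1 : 0 < Num.sqrt r by rewrite sqrtr_gt0.
  have [n] := s_dense (phi t) _ r1; rewrite hnorm_lt ?ltW// sqr_sqrtr ?ltW// => hn.
  exists (pickle (n, m)) => //; rewrite /Q pickleK /=; split => //.
    by apply: le_trans rw; rewrite lee_fin ltW.
  move=> k; apply: le_trans rw; rewrite lee_fin.
  have := rip_ge0 hilb ((phi t - s n) - s k).
  rewrite [X in 0 <= X](_ : _ = rip (phi t - s n) (phi t - s n)
    - 2 * rip (s k) (phi t - s n) + rip (s k) (s k)); first by lra.
  by rewrite (ripDl hilb _ (- s k)) !(ripDr hilb _ (- s k)) !(ripNl hilb) !(ripNr hilb)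
    (rip_sym hilb (phi t - s n) (s k)); ring.
(* [rip_dense_le] turns the countable test back into [|phi t - x|^2 <= w t], and Cauchy-Schwarz
   gives the bound for every [f]; an infinite [w t] is handled apart. *)
have dist j t : D j t -> exists x, forall f,
  (x = s (odflt (0%N, 0%N) (unpickle j)).1) /\
  ((cabs2 (ip f (phi t - x)))%:E <= (rip f f)%:E * w t)%E.
  move=> /DQ[_ _ h]; eexists => f; split; first reflexivity.
  set x := s _ in h *.
  apply: (@le_trans _ _ ((rip f f)%:E * (rip (phi t - x) (phi t - x))%:E)%E).
    by rewrite -EFinM lee_fin; exact: cabs2_ip_le.
  apply: lee_wpmul2l; first by rewrite lee_fin rip_ge0.
  case: (w t) h (w0 t) => [r h _|_ _|//]; last exact: leey.
  by rewrite lee_fin; apply: (rip_dense_le hilb s_dense) => k; rewrite -lee_fin.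
have [F FD] : exists F : nat -> set X, forall j,
    [/\ measurable (F j), F j `<=` D j & mu (F j) = (l%:E * mu (D j))%E].
  suff /choice[F hF] : forall j, exists F, [/\ measurable F, F `<=` D j &
     mu F = (l%:E * mu (D j))%E] by exists F.
  move=> j; have Dfin : (mu (D j) < +oo)%E.
    apply: (@le_lt_trans _ _ (mu (Q j))); last exact: Pfin.
    by apply: le_measure; rewrite ?inE.
  have [l0 l1] := andP l01.
  have DE : mu (D j) = (fine (mu (D j)))%:E by rewrite fineK// ge0_fin_numE.
  have [||G [mG GD GE]] := nonatomic_intermediate na (mD j) Dfin (c := l * fine (mu (D j))).
  - by rewrite mulr_ge0// fine_ge0.
  - by rewrite DE lee_fin /= ler_piMl// fine_ge0.
  - by exists G; split => //; rewrite GE DE -EFinM.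
have mF j : measurable (F j) by have [] := FD j.
have FsubD j : F j `<=` D j by have [] := FD j.
have muF j : mu (F j) = (l%:E * mu (D j))%E by have [] := FD j.
exists (\bigcup_j F j); split; first exact: bigcup_measurable.
  by apply: bigcup_sub => j _; apply: subset_trans (DA j).
move=> f.
(* The pieces and [F] are already fixed, which gives uniformity in [f]; only the error [G] and the
   constants [q] depend on it. *)
pose G t := ((del * coef2 f t)%:E + ((1 + del^-1) * rip f f)%:E * w t)%E.
pose q j := cabs2 (ip f (s (odflt (0%N, 0%N) (unpickle j)).1)).
have rf0 := rip_ge0 hilb f.
have c0 : (0 <= ((1 + del^-1) * rip f f)%:E)%E by rewrite lee_fin mulr_ge0// ltW.
have c0' : (0 <= del%:E)%E by rewrite lee_fin ltW.
have G0 t : (0 <= G t)%E.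
  by apply: adde_ge0; rewrite ?mule_ge0// EFinM mule_ge0// lee_fin coef2_ge0.
have mG1 : measurable_fun setT (fun t => (del * coef2 f t)%:E).
  by apply/measurable_EFinP; apply: measurable_funM => //; exact: measurable_coef2.
have mG : measurable_fun setT G.
  by apply: emeasurable_funD => //; exact: measurable_funeM.
have intG : (\int[mu]_(t in \bigcup_j D j) G t <= (e / 2 * rip f f)%:E)%E.
  apply: (@le_trans _ _ (\int[mu]_t G t)%E); first exact: ge0_subset_integral.
  rewrite ge0_integralD//=; last 3 first.
  - by move=> t _; rewrite EFinM mule_ge0// lee_fin coef2_ge0.
  - by move=> t _; rewrite mule_ge0.
  - exact: measurable_funeM.
  under eq_integral do rewrite EFinM.
  rewrite ge0_integralZl_EFin//; last 2 first.
  - by move=> t _; rewrite lee_fin coef2_ge0.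
  - exact: measurable_coef2_EFin.
  rewrite ge0_integralZl//.
  apply: (@le_trans _ _ (del%:E * (B * rip f f)%:E
    + ((1 + del^-1) * rip f f)%:E * eta%:E)%E).
    by apply: leeD; apply: lee_wpmul2l.
  rewrite -!EFinM -EFinD lee_fin.
  have -> : (1 + del^-1) * rip f f * eta = e / 4 * rip f f.
    rewrite /eta; move: (1 + del^-1) idel0 => K K0.
    by field; rewrite gt_eqF.
  have : del * (B + 1) = e / 4 by rewrite /del; field; rewrite gt_eqF// ltr_wpDl.
  move: del0 => d0 dE; have -> : del * (B * rip f f) = (e / 4 - del) * rip f f.
    by rewrite -dE; ring.
  by have := mulr_ge0 (ltW d0) rf0; lra.
have both j t : D j t -> ((coef2 f t)%:E <= (q j)%:E + G t)%E /\
    ((q j)%:E <= (coef2 f t)%:E + G t)%E.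
  move=> Djt; have [x hx] := dist _ _ Djt; have [xE hd] := hx f.
  have [] := cabs2_perturb (ip f (phi t)) (ip f x) del0.
  rewrite -(ipNr hilb) -(ipDr hilb) -/(coef2 f t) {1 3}xE -/(q j) => h1 h2.
  have hG : ((del * coef2 f t + (1 + del^-1) * cabs2 (ip f (phi t - x)))%:E <= G t)%E.
    rewrite EFinD; apply: leeD => //; rewrite !EFinM -muleA.
    by apply: lee_wpmul2l => //; rewrite lee_fin ltW.
  split; [apply: (le_trans _ (leeD (lexx _) hG))..]; by rewrite -EFinD lee_fin.
rewrite (integral_coef2_support f mA mUD UDA AUD).
have eE : (e * rip f f)%:E = ((e / 2 * rip f f)%:E + (e / 2 * rip f f)%:E)%E.
  by rewrite -EFinD; congr EFin; field.
have bal := balanced_integral_le mD tD (measurable_coef2_EFin f) mG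
  (fun t => _) G0 (fun j => _) (fun j t h => (both j t h).1) (fun j t h => (both j t h).2).
have intG2 x : (x + (\int[mu]_(t in \bigcup_j D j) G t + \int[mu]_(t in \bigcup_j D j) G t)
    <= x + (e * rip f f)%:E)%E by rewrite eE; apply: leeD => //; exact: leeD.
(* The balancing lemma is used with weights [(1, l)] from [F] to [D], then with [(l, 1)] from [D] to
   [F]. *)
split; apply: le_trans (intG2 _).
- rewrite -[leLHS]mul1e; apply: bal => //.
  + by move=> t; rewrite lee_fin coef2_ge0.
  + by move=> j; exact: cabs2_ge0.
  + by rewrite ler01 lexx.
  + by move=> j; exact: subset_refl.
  + by move=> j; rewrite mul1e.
- rewrite -[X in (_ <= X + _)%E]mul1e; apply: bal => //.
  + by move=> t; rewrite lee_fin coef2_ge0.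
  + by move=> j; exact: cabs2_ge0.
  + by rewrite ler01 lexx.
  + by move=> j; exact: subset_refl.
  + by move=> j; rewrite mul1e.
Qed.

(** * Real bilinear forms and partial frame operators *)

Definition frame_cross (f g : H) (t : X) : R :=
  complex.Re (ip f (phi t) * ip (phi t) g).

Definition frame_form (E : set X) (f g : H) : R :=
  Rintegral mu E (frame_cross f g).

(** The right side is the inner product of the two coefficients as plane vectors, so symmetry in [f]
    and [g] becomes visible. *)
Lemma frame_crossE f g t : frame_cross f g t =
  complex.Re (ip f (phi t)) * complex.Re (ip g (phi t)) +
  complex.Im (ip f (phi t)) * complex.Im (ip g (phi t)).
Proof.
rewrite /frame_cross (ipC hilb (phi t) g).
by case: (ip f (phi t)) (ip g (phi t)) => a b [a' b'] /=; ring.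
Qed.

Lemma frame_cross_diag f t : frame_cross f f t = coef2 f t.
Proof. by rewrite frame_crossE -!expr2. Qed.

Lemma integrable_coef2 E f : measurable E -> mu.-integrable E (EFin \o coef2 f).
Proof.
move=> mE; apply/integrableP; split.
  exact/measurable_funTS/measurable_coef2_EFin.
have [B [_ hB]] := bessel_bound; apply: le_lt_trans (ltry (B * rip f f)).
apply: le_trans (hB f).
under eq_integral => t _ do rewrite /= ger0_norm ?coef2_ge0//.
apply: ge0_subset_integral => //; first exact: measurable_coef2_EFin.
by move=> t _; rewrite lee_fin coef2_ge0.
Qed.

(** Dominated by [coef2 f + coef2 g], which the Bessel bound makes integrable. *)
Lemma integrable_frame_cross E f g : measurable E ->
  mu.-integrable E (EFin \o frame_cross f g).
Proof.
move=> mE; have := integrableD mE (integrable_coef2 f mE) (integrable_coef2 g mE).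
apply: le_integrable => //.
  apply/measurable_EFinP/measurable_funTS.
  rewrite (_ : frame_cross f g = fun t =>
    complex.Re (ip f (phi t)) * complex.Re (ip g (phi t)) +
    complex.Im (ip f (phi t)) * complex.Im (ip g (phi t))).
    by apply: measurable_funD; apply: measurable_funM;
      [exact: measurable_Re_ip.. | exact: measurable_Im_ip | exact: measurable_Im_ip].
  by apply/funext => t; rewrite frame_crossE.
move=> t _ /=; rewrite lee_fin [leRHS]ger0_norm; last first.
  by apply: addr_ge0; exact: coef2_ge0.
rewrite frame_crossE /coef2 /cabs2.
case: (ip f (phi t)) (ip g (phi t)) => a b [a' b'] /=.
have := sqr_ge0 (a + a'); have := sqr_ge0 (a - a').
have := sqr_ge0 (b + b'); have := sqr_ge0 (b - b').
rewrite ler_norml => *; have := sqr_ge0 a; have := sqr_ge0 b.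
have := sqr_ge0 a'; have := sqr_ge0 b'.
by move=> *; apply/andP; split; nra.
Qed.

Lemma frame_form_sym E f g : frame_form E f g = frame_form E g f.
Proof.
apply: eq_Rintegral => t _.
rewrite -/(frame_cross f g t) -/(frame_cross g f t) !frame_crossE.
by congr (_ + _); exact: mulrC.
Qed.

Lemma frame_formDr E f g h : measurable E ->
  frame_form E f (g + h) = frame_form E f g + frame_form E f h.
Proof.
move=> mE; rewrite /frame_form -RintegralD//; try exact: integrable_frame_cross.
by apply: eq_Rintegral => t _; rewrite /frame_cross (ipDr hilb) mulrDr ReD.
Qed.

Lemma frame_formZr E f g (r : R) : measurable E ->
  frame_form E f ((r%:C)%C *: g) = r * frame_form E f g.
Proof.
move=> mE; rewrite /frame_form -RintegralZl//; last exact: integrable_frame_cross.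
apply: eq_Rintegral => t _; rewrite /frame_cross (ipZr hilb) -ReZ; congr complex.Re.
by rewrite conjc_real mulrCA.
Qed.

Lemma frame_formNr E f g : measurable E ->
  frame_form E f (- g) = - frame_form E f g.
Proof.
by move=> mE; rewrite -scaleN1r -(rmorphN1 (real_complex R)) frame_formZr// mulN1r.
Qed.

Lemma frame_formDl E f g h : measurable E ->
  frame_form E (g + h) f = frame_form E g f + frame_form E h f.
Proof. by move=> mE; rewrite !(frame_form_sym _ _ f) frame_formDr. Qed.

Lemma frame_formZl E f g (r : R) : measurable E ->
  frame_form E ((r%:C)%C *: g) f = r * frame_form E g f.
Proof. by move=> mE; rewrite !(frame_form_sym _ _ f) frame_formZr. Qed.

Lemma frame_formNl E f g : measurable E ->
  frame_form E (- g) f = - frame_form E g f.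
Proof. by move=> mE; rewrite !(frame_form_sym _ _ f) frame_formNr. Qed.

(** Links the real-valued form to the extended integrals of the discretization. *)
Lemma frame_form_diag E f : measurable E ->
  (frame_form E f f)%:E = (\int[mu]_(t in E) (coef2 f t)%:E)%E.
Proof.
move=> mE; rewrite /frame_form /Rintegral fineK.
  by apply: eq_integral => t _; rewrite frame_cross_diag.
exact/integrable_fin_num/integrable_frame_cross.
Qed.

Lemma frame_form_diag_ge0 E f : measurable E -> 0 <= frame_form E f f.
Proof.
move=> mE; rewrite -lee_fin frame_form_diag//; apply: integral_ge0 => t _.
by rewrite lee_fin coef2_ge0.
Qed.

Lemma frame_form_diag_le : exists B : R, 0 <= B /\
  forall E f, measurable E -> frame_form E f f <= B * rip f f.
Proof.
have [B [B0 hB]] := bessel_bound; exists B; split => // E f mE.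
rewrite -lee_fin frame_form_diag//; apply: le_trans (hB f).
apply: ge0_subset_integral => //; first exact: measurable_coef2_EFin.
by move=> t _; rewrite lee_fin coef2_ge0.
Qed.

Lemma frame_form_setU E F f : measurable E -> measurable F -> E `&` F = set0 ->
  frame_form (E `|` F) f f = frame_form E f f + frame_form F f f.
Proof.
move=> mE mF EF; apply/EFin_inj; rewrite EFinD !frame_form_diag//; last exact: measurableU.
rewrite ge0_integral_setU//.
- exact/measurable_funTS/measurable_coef2_EFin.
- by move=> t _; rewrite lee_fin coef2_ge0.
- by rewrite disj_set2E EF.
Qed.

Lemma partial_frame_operator_rip E S f g :
  partial_frame_operator mu ip phi E S -> rip (S f) g = frame_form E f g.
Proof. by move=> hS; rewrite /rip hS. Qed.

(** Riesz representation of [frame_form E f] for each [f]. *)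
Lemma exists_partial_frame_operator E : measurable E ->
  exists S, partial_frame_operator mu ip phi E S.
Proof.
move=> mE; suff /choice[S hS] : forall f, exists x, forall g,
    ip x g = cintegral mu E (fun t => ip f (phi t) * ip (phi t) g).
  by exists S => f g; exact: hS.
move=> f; have [|||x hx] := riesz hilb (l := frame_form E f).
- by move=> g h; exact: frame_formDr.
- by move=> r g; exact: frame_formZr.
- have [B [B0 hB]] := frame_form_diag_le.
  (* The bound required by [riesz] comes from positivity of the form at [(B + 1) f - x]; the added 1
     allows division by the factor. *)
  have M0 : 0 < B + 1 by rewrite ltr_wpDl.
  exists ((B + 1) * frame_form E f f) => x; rewrite -(ler_pM2l M0).
  have := frame_form_diag_ge0 (((B + 1)%:C)%C *: f - x) mE.
  rewrite !(frame_formDr, frame_formDl, frame_formNr, frame_formNl, frame_formZl, frame_formZr)//.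
  rewrite (frame_form_sym _ x f).
  by have := hB E x mE; have := rip_ge0 hilb x; lra.
(* Testing the real identity at ['i g] yields the imaginary part. *)
exists x => g; have -> : ip x g = Complex (rip x g) (rip x ('i%C *: g)).
  by rewrite (ip_imag hilb) /rip; case: (ip x g).
rewrite !hx; congr Complex; apply: eq_Rintegral => t _.
rewrite /frame_cross (ipZr hilb).
by case: (ip f (phi t)) (ip (phi t) g) => a b [a' b'] /=; ring.
Qed.

(** Positivity at [x - y] bounds twice the form by its two diagonal values. The bound makes the
    supremum in [opnorm] meaningful. *)
Lemma partial_frame_operator_bounded E S : measurable E ->
  partial_frame_operator mu ip phi E S ->
  exists K, forall x, hnorm ip x <= 1 -> hnorm ip (S x) <= K.
Proof.
move=> mE hS; have [B [B0 hB]] := frame_form_diag_le; exists B => x.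
rewrite (hnorm_le hilb)// expr1n => x1; apply: (hnorm_le1_unit hilb) => // y.
rewrite (hnorm_le hilb)// expr1n => y1; rewrite (partial_frame_operator_rip _ _ hS).
have := frame_form_diag_ge0 (x - y) mE.
rewrite !(frame_formDr, frame_formDl, frame_formNr, frame_formNl)// (frame_form_sym _ y x).
have := hB E x mE; have := hB E y mE.
by have := ler_wpM2l B0 x1; have := ler_wpM2l B0 y1; lra.
Qed.

Lemma frame_form_subset (A : set X) (l e : R) :
  measurable A -> 0 <= l <= 1 -> 0 < e ->
  exists F, [/\ measurable F, F `<=` A & forall f,
    `|frame_form F f f - l * frame_form A f f| <= e * rip f f].
Proof.
move=> mA l01 e0; have [F [mF FA hF]] := frame_proportional_subset mA l01 e0.
exists F; split => // f; have [] := hF f.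
rewrite -!frame_form_diag// -!EFinM -!EFinD !lee_fin ler_norml => h1 h2.
by apply/andP; split; lra.
Qed.

Lemma frame_form_convex (A1 A2 : set X) (l e : R) :
  measurable A1 -> measurable A2 -> 0 <= l <= 1 -> 0 < e ->
  exists E, measurable E /\ forall f,
    `|l * frame_form A1 f f + (1 - l) * frame_form A2 f f - frame_form E f f|
      <= e * rip f f.
Proof.
move=> mA1 mA2 l01 e0; have e2 : 0 < e / 2 by rewrite divr_gt0.
have l01' : 0 <= 1 - l <= 1 by case/andP: l01 => ? ?; apply/andP; split; lra.
have m12 : measurable (A1 `\` A2) by exact: measurableD.
have m21 : measurable (A2 `\` A1) by exact: measurableD.
have mI : measurable (A1 `&` A2) by exact: measurableI.
have [F1 [mF1 F1A hF1]] := frame_form_subset m12 l01 e2.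
have [F2 [mF2 F2A hF2]] := frame_form_subset m21 l01' e2.
have mFU : measurable (F1 `|` F2) by exact: measurableU.
(* On the intersection the weights add up to 1, so it enters whole; each difference contributes an
   error [e/2]. *)
exists ((A1 `&` A2) `|` (F1 `|` F2)); split; first exact: measurableU.
move=> f; rewrite !frame_form_setU//; last 2 first.
- by apply/seteqP; split => // t [/F1A[_ nA2] /F2A[A2t]].
- by apply/seteqP; split => // t [[A1t A2t] [/F1A[]|/F2A[]]].
have -> : frame_form A1 f f = frame_form (A1 `&` A2) f f + frame_form (A1 `\` A2) f f.
  rewrite -frame_form_setU//; first by rewrite setUIDK.
  by apply/seteqP; split => // t [[_ ?] []].
have -> : frame_form A2 f f = frame_form (A1 `&` A2) f f + frame_form (A2 `\` A1) f f.
  rewrite -frame_form_setU//; first by rewrite setIC setUIDK.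
  by apply/seteqP; split => // t [[? _] []].
have := hF1 f; have := hF2 f; rewrite !ler_norml => /andP[h1 h2] /andP[h3 h4].
by apply/andP; split; lra.
Qed.

(** Polarization: four times the form of the difference is its quadratic form at [x + y] minus that
    at [x - y], hence at most [2e (|x|^2 + |y|^2) <= 4e] on the unit ball. *)
Lemma partial_frame_operator_convex (A1 A2 : set X) (S1 S2 : H -> H) (l e : R) :
  measurable A1 -> measurable A2 ->
  partial_frame_operator mu ip phi A1 S1 ->
  partial_frame_operator mu ip phi A2 S2 -> 0 <= l <= 1 -> 0 < e ->
  exists2 S, partial_frame_operators mu ip phi S & forall x, hnorm ip x <= 1 ->
    hnorm ip ((l%:C)%C *: S1 x + ((1 - l)%:C)%C *: S2 x - S x) <= e.
Proof.
move=> mA1 mA2 hS1 hS2 l01 e0.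
have [E [mE hE]] := frame_form_convex mA1 mA2 l01 e0.
have [S hS] := exists_partial_frame_operator mE.
exists S; first by exists E.
move=> x; rewrite (hnorm_le hilb)// expr1n => x1.
apply: (hnorm_le1_unit hilb); first exact: ltW.
move=> y; rewrite (hnorm_le hilb)// expr1n => y1.
rewrite !(ripE hilb) (partial_frame_operator_rip _ _ hS1).
rewrite (partial_frame_operator_rip _ _ hS2) (partial_frame_operator_rip _ _ hS).
have := hE (x + y); have := hE (x - y); rewrite !ler_norml.
rewrite !(frame_formDr, frame_formDl, frame_formNr, frame_formNl)//.
rewrite !(ripE hilb) !(frame_form_sym _ y x) (rip_sym hilb y x).
move=> /andP[h1 h2] /andP[h3 h4].
have := ler_wpM2l (ltW e0) x1; have := ler_wpM2l (ltW e0) y1.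
lra.
Qed.

End Frame.

(** * Operator norm estimates *)

Section OperatorNorm.
Variables (R : realType) (H : lmodType R[i]) (ip : H -> H -> R[i]).
Hypothesis hilb : separable_hilbert ip.

(** [K] certifies that the supremum is over a bounded set; otherwise [sup] would be a default
    value. *)
Lemma le_opnorm (V : H -> H) (K : R) x :
  (forall z, hnorm ip z <= 1 -> hnorm ip (V z) <= K) ->
  hnorm ip x <= 1 -> hnorm ip (V x) <= opnorm ip V.
Proof.
move=> hV x1; apply: sup_ubound; last by exists x.
by exists K => _ [z /= z1 <-]; exact: hV.
Qed.

Lemma opnorm_le (V : H -> H) (K : R) :
  (forall z, hnorm ip z <= 1 -> hnorm ip (V z) <= K) -> opnorm ip V <= K.
Proof.
move=> hV; apply: ge_sup; last by move=> _ [z /= z1 <-]; exact: hV.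
exists (hnorm ip (V 0)), 0 => //=.
by rewrite (hnorm_le hilb)// (rip0l hilb) expr1n.
Qed.

Lemma bounded_operator_convex (T1 T2 : H -> H) (l : R) : 0 <= l <= 1 ->
  bounded_operator ip T1 -> bounded_operator ip T2 ->
  bounded_operator ip (fun x => (l%:C)%C *: T1 x + ((1 - l)%:C)%C *: T2 x).
Proof.
move=> /andP[l0 l1] [lin1 [c1 h1]] [lin2 [c2 h2]]; split.
  move=> a x y; rewrite lin1 lin2 !scalerDr !scalerA addrACA.
  by rewrite !(mulrC a).
exists (l * c1 + (1 - l) * c2) => x.
apply: le_trans (hnormD hilb _ _) _; rewrite !(hnormZ hilb) !ger0_norm ?subr_ge0//.
rewrite [leRHS]mulrDl -!mulrA; apply: lerD; apply: ler_wpM2l => //.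
by rewrite subr_ge0.
Qed.

Lemma bounded_operator_unit (T : H -> H) : bounded_operator ip T ->
  exists K, forall x, hnorm ip x <= 1 -> hnorm ip (T x) <= K.
Proof.
move=> [_ [c hc]]; exists `|c| => x x1; apply: le_trans (hc x) _.
apply: (@le_trans _ _ (`|c| * hnorm ip x)).
  by rewrite ler_wpM2r ?hnorm_ge0// ler_norm.
by rewrite ler_piMr.
Qed.

Lemma hnormB (x y : H) : hnorm ip (x - y) <= hnorm ip x + hnorm ip y.
Proof.
apply: le_trans (hnormD hilb _ _) _.
by rewrite [hnorm ip (- y)]hnormE (ripNl hilb) (ripNr hilb) opprK.
Qed.

End OperatorNorm.

Theorem theorem3p4 (R : realType) (d : measure_display) (X : measurableType d)
  (mu : {measure set X -> \bar R}) (H : lmodType R[i]) (ip : H -> H -> R[i])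
  (phi : X -> H) :
  nonatomic mu -> separable_hilbert ip -> bessel_family mu ip phi ->
  convex_opset (opnorm_closure ip (partial_frame_operators mu ip phi)).
Proof.
move=> na hilb bessel T1 T2 [bT1 cT1] [bT2 cT2] l l01.
split; first exact: bounded_operator_convex.
(* The two approximations cost [l e/4 + (1 - l) e/4] and the convexity error another [e/4]. The
   total [e/2] leaves room for the strict inequality, since [opnorm_le] gives only a weak one. *)
move=> e e0; have e4 : 0 < e / 4 by rewrite divr_gt0.
have [S1 [A1 [mA1 hS1]] nS1] := cT1 _ e4.
have [S2 [A2 [mA2 hS2]] nS2] := cT2 _ e4.
have [S SS hS] := partial_frame_operator_convex hilb bessel na mA1 mA2 hS1 hS2 l01 e4.
exists S => //; apply: (@le_lt_trans _ _ (e / 2)); last by lra.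
apply: (opnorm_le hilb) => x x1.
(* [T] and [S'] are bounded on the unit ball, so the norm of their difference is a genuine supremum
   and controls each vector there. *)
have close T A S' : bounded_operator ip T -> measurable A ->
    partial_frame_operator mu ip phi A S' ->
    opnorm ip (fun x => T x - S' x) < e / 4 -> hnorm ip (T x - S' x) <= e / 4.
  move=> bT mA hS' nS'.
  have [K1 hK1] := bounded_operator_unit bT.
  have [K2 hK2] := partial_frame_operator_bounded hilb bessel mA hS'.
  apply: le_trans (ltW nS').
  apply: (le_opnorm (V := fun x => T x - S' x) (K := K1 + K2)) => // z z1.
  by apply: le_trans (hnormB hilb _ _) _; rewrite lerD ?hK1 ?hK2.
have -> : (l%:C)%C *: T1 x + ((1 - l)%:C)%C *: T2 x - S x =
    ((l%:C)%C *: (T1 x - S1 x) + ((1 - l)%:C)%C *: (T2 x - S2 x)) +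
    ((l%:C)%C *: S1 x + ((1 - l)%:C)%C *: S2 x - S x).
  by rewrite !scalerBr [RHS]addrA; congr (_ + _); rewrite [RHS]addrACA !subrK.
apply: le_trans (hnormD hilb _ _) _.
have [l0 l1] := andP l01; have l1' : 0 <= 1 - l by rewrite subr_ge0.
have := hnormD hilb ((l%:C)%C *: (T1 x - S1 x)) (((1 - l)%:C)%C *: (T2 x - S2 x)).
rewrite !(hnormZ hilb) !ger0_norm//.
have := ler_wpM2l l0 (close _ _ _ bT1 mA1 hS1 nS1).
have := ler_wpM2l l1' (close _ _ _ bT2 mA2 hS2 nS2).
have := hS x x1; lra.
Qed.
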